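(* Let $n\ge 2$ and $d\ge 2$ be integers, and let $\Upsilon$ be the Choi state of an $n$-step process tensor (as defined in the context). Then $$\mathrm{M}\le 2n\ln d-\frac{2^n-1}{2^n-2}\,\mathrm{N}.$$
   Context: An $n$-step process tensor with system dimension $d$ is represented by its Choi state $\Upsilon$, a density operator on $\mathcal{H}_{\mathrm{i}_0}\otimes\mathcal{H}_{\mathrm{o}_1}\otimes\cdots\otimes\mathcal{H}_{\mathrm{i}_{n-1}}\otimes\mathcal{H}_{\mathrm{o}_n}$ (each factor of dimension $d$) satisfying: for all $1\le j\le n$, $\mathrm{tr}_{\mathrm{o}_j}[\Upsilon_{1:j}]=\Upsilon_{1:j-1}\otimes\mathbb{I}_{\mathrm{i}_{j-1}}/d$, where $\Upsilon_{1:j}$ is the partial trace of $\Upsilon$ over $\mathrm{i}_j,\mathrm{o}_{j+1},\dots,\mathrm{i}_{n-1},\mathrm{o}_n$ (with $\Upsilon_{1:n}=\Upsilon$, $\Upsilon_{1:0}=1$). Entropies are von Neumann with natural log; $S_{\mathrm{i}_{j-1}},S_{\mathrm{o}_j}$ are single-factor marginal entropies of $\Upsilon$, $S_j$ the entropy of its marginal on $\mathrm{i}_{j-1}\mathrm{o}_j$, $S_{1:n}=S(\Upsilon)$. Total Markovian correlations: $\mathrm{M}=\sum_{j=1}^n(S_{\mathrm{i}_{j-1}}+S_{\mathrm{o}_j}-S_j)$; non-Markovian correlations: $\mathrm{N}=\sum_{j=1}^n S_j-S_{1:n}$. *)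

(* Defs.v *)
From HB Require Import structures.
From mathcomp Require Import all_boot all_order all_algebra.
From mathcomp Require Import complex.
From mathcomp Require Import reals exp.
Set Implicit Arguments. Unset Strict Implicit. Unset Printing Implicit Defensive.
Import Order.TTheory GRing.Theory Num.Theory.
Local Open Scope ring_scope.

Section QDefs.
Variables (R : realType) (d k : nat).
(* k tensor factors ('I_k), each of dimension d; C = R[i]. *)
Local Notation C := R[i].

(* Basis labels of the subsystem A : assignments of a level in 'I_d to each factor of A. *)
Definition cfg (A : {set 'I_k}) := {ffun {i : 'I_k | i \in A} -> 'I_d}.

Definition op (A : {set 'I_k}) := 'M[C]_#|{: cfg A}|.

Definition entry (A : {set 'I_k}) (rho : op A) (x y : cfg A) : C :=
  rho (enum_rank x) (enum_rank y).

Lemma glue_mem (A B : {set 'I_k}) (i : {i : 'I_k | i \in A}) :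
  val i \notin B -> val i \in A :\: B.
Proof. by move=> h; rewrite inE h (valP i). Qed.

Definition glue (A B : {set 'I_k}) (x : cfg B) (z : cfg (A :\: B)) : cfg A :=
  [ffun i => match boolP (val i \in B) with
             | AltTrue h => x (exist _ (val i) h)
             | AltFalse h => z (exist _ (val i) (glue_mem h))
             end].

(* Partial trace of rho (on A) over A \ B, giving the marginal on B (B ⊆ A). *)
Definition ptr (A B : {set 'I_k}) (rho : op A) : op B :=
  \matrix_(i, j) \sum_(z : cfg (A :\: B))
      entry rho (glue (enum_val i) z) (glue (enum_val j) z).

Definition marg (B : {set 'I_k}) (rho : op [set: 'I_k]) : op B := ptr B rho.

End QDefs.

Section Entropy.
Variable (R : realType).
Local Notation C := R[i].

Definition conjT (m n : nat) (A : 'M[C]_(m, n)) : 'M[C]_(n, m) := (map_mx Num.conj A)^T.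

Definition psd (N : nat) (A : 'M[C]_N) : Prop :=
  forall v : 'cV[C]_N, 0 <= (conjT v *m A *m v) 0 0.

Definition density (N : nat) (A : 'M[C]_N) : Prop := psd A /\ \tr A = 1.

Definition spectrum (N : nat) (A : 'M[C]_N) : seq C :=
  sval (closed_field_poly_normal (char_poly A)).

Definition vN_entropy (N : nat) (A : 'M[C]_N) : R :=
  - \sum_(l <- spectrum A) complex.Re l * ln (complex.Re l).

End Entropy.

Section ProcessTensor.
Variables (R : realType) (d n : nat).
(* Factors are labelled by 'I_(2*n): position 2*j is i_j (j = 0..n-1),
   position 2*j+1 is o_(j+1). *)
Local Notation K := (2 * n)%N.

Definition first (m : nat) : {set 'I_K} := [set i : 'I_K | (i < m)%N].
Definition inp (j : nat) : {set 'I_K} := [set i : 'I_K | val i == (2 * j)%N].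
Definition outp (j : nat) : {set 'I_K} := [set i : 'I_K | val i == (2 * j).+1].

Definition S (rho : op R d [set: 'I_K]) (B : {set 'I_K}) : R :=
  vN_entropy (marg B rho).

Definition Ups (rho : op R d [set: 'I_K]) (j : nat) : op R d (first (2 * j)) :=
  marg (first (2 * j)) rho.

(* Causality constraint for the step j+1 (j = 0..n-1):
   tr_{o_(j+1)} Ups_{1:j+1} = Ups_{1:j} (x) I_{i_j} / d . *)
Definition causal_step (rho : op R d [set: 'I_K]) (j : nat) : Prop :=
  let lhs := ptr (first (2 * j).+1) (Ups rho j.+1) in
  forall (x y : cfg d (first (2 * j)))
         (u v : cfg d (first (2 * j).+1 :\: first (2 * j))),
    entry lhs (glue x u) (glue y v) =
    entry (Ups rho j) x y * ((u == v)%:R / d%:R).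

Definition process_tensor (rho : op R d [set: 'I_K]) : Prop :=
  density rho /\ forall j, (j < n)%N -> causal_step rho j.

Definition markov_corr (rho : op R d [set: 'I_K]) : R :=
  \sum_(j < n) (S rho (inp j) + S rho (outp j) - S rho (inp j :|: outp j)).

Definition nonmarkov_corr (rho : op R d [set: 'I_K]) : R :=
  \sum_(j < n) S rho (inp j :|: outp j) - vN_entropy rho.

End ProcessTensor.

(* Main.v *)
(** Write [T_j] for the entropy of the marginal on the first [j] steps and [S] for
    that of the whole state.  Causality makes the input [i_(j+1)] maximally mixed
    and uncorrelated with the past, so that the marginal on the first [j] steps
    together with [i_(j+1)] has entropy [T_j + ln d]; by the Araki-Lieb inequality
    tracing out [o_(j+1)] changes the entropy by at most [ln d], hence
    [T_j <= T_(j+1)] and all [T_j] are at most [S].  The Araki-Lieb inequality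
    applied to a single step and its past gives [S_(j+1) <= T_j + T_(j+1) <= 2 S],
    and [S_1 = T_1 <= S].  Thus the single-step entropies add up to at most
    [(2 n - 1) S <= (2 ^ n - 1) S], and this is the bound claimed once every
    one-factor entropy has been replaced by its upper bound [ln d].

    Araki-Lieb is proved by purification from subadditivity, and subadditivity
    from Klein's inequality in the product of the eigenbases of the two marginals.
    The only spectral fact needed about non-Hermitian products is that [A B] and
    [B A] have the same non-zero spectrum. *)

Require Import Defs.
From HB Require Import structures.
From mathcomp Require Import all_boot all_order all_algebra.
From mathcomp Require Import complex.
From mathcomp Require Import reals exp.
From mathcomp Require Import zify ring lra.
Set Implicit Arguments. Unset Strict Implicit. Unset Printing Implicit Defensive.
Import Order.TTheory GRing.Theory Num.Theory.
Local Open Scope ring_scope.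

(** * Entropy and spectra *)

(** Two triangular factors clear one off-diagonal block each of the block matrix with rows [X, A]
    and [B, 1]. Comparing the two resulting values of its determinant gives the identity. *)
Lemma char_poly_mulC (F : comNzRingType) m n (A : 'M[F]_(m, n)) (B : 'M[F]_(n, m)) :
  'X^n * char_poly (A *m B) = 'X^m * char_poly (B *m A).
Proof.
pose A' := map_mx polyC A; pose B' := map_mx polyC B.
pose M := block_mx 'X%:M A' B' 1%:M.
have detAB : \det M = char_poly (A *m B).
  have := det_mulmx M (block_mx 1%:M 0 (- B') 1%:M).
  rewrite det_lblock !det1 !mulr1 => <-.
  rewrite mulmx_block !mulmx0 !mulmx1 mul1mx addrN add0r add0r det_ublock det1 mulr1.
  by rewrite mulmxN /char_poly /char_poly_mx map_mxM.
have detBA : \det M * 'X^n = 'X^m * char_poly (B *m A).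
  have := det_mulmx M (block_mx 1%:M (- A') 0 'X%:M).
  rewrite det_ublock det1 mul1r det_scalar => <-.
  rewrite mulmx_block !mulmx0 !mulmx1 addr0 addr0 mul_scalar_mx mul_mx_scalar.
  rewrite scalerN addNr det_lblock det_scalar mulmxN.
  by rewrite /char_poly /char_poly_mx map_mxM [- _ + _]addrC mul1mx.
by rewrite -detBA detAB mulrC.
Qed.

Section Entropy.
Variable R : realType.
Local Notation C := R[i].

Lemma spectrumE N (A : 'M[C]_N) : char_poly A = \prod_(z <- spectrum A) ('X - z%:P).
Proof.
rewrite /spectrum; case: closed_field_poly_normal => r /= {1}->.
by rewrite (monicP (char_poly_monic A)) scale1r.
Qed.

(** The definition of [spectrum] picks some list of roots. Unique factorization makes it a
    permutation of [s], and the entropy sum ignores the order. *)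
Lemma vN_entropy_seq N (A : 'M[C]_N) (s : seq C) :
  char_poly A = \prod_(z <- s) ('X - z%:P) ->
  vN_entropy A = - \sum_(l <- s) complex.Re l * ln (complex.Re l).
Proof.
rewrite spectrumE => /prod_XsubC_eq pA.
by rewrite /vN_entropy (perm_big _ pA).
Qed.

(* Missing eigenvalues are zeros, for which [0 * ln 0 = 0]. *)
Lemma vN_entropy_mulC m n (A : 'M[C]_(m, n)) (B : 'M[C]_(n, m)) :
  vN_entropy (A *m B) = vN_entropy (B *m A).
Proof.
have Xn k : 'X^k = \prod_(z <- nseq k (0 : C)) ('X - z%:P).
  by rewrite big_nseq subr0 -Monoid.iteropE.
have := char_poly_mulC A B.
rewrite !spectrumE !Xn -!big_cat => /prod_XsubC_eq pAB.
pose g (l : C) := complex.Re l * ln (complex.Re l).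
have := perm_big _ pAB : \sum_(l <- _) g l = \sum_(l <- _) g l.
have Z k : \sum_(l <- nseq k (0 : C)) g l = 0.
  by rewrite big1_seq // => l /andP[_ /nseqP[-> _]] /=; rewrite /g /= mul0r.
by rewrite !big_cat /= !Z !add0r /vN_entropy => ->.
Qed.

Lemma vN_entropy_diag n (D : 'rV[C]_n) :
  vN_entropy (diag_mx D) = - \sum_i complex.Re (D 0 i) * ln (complex.Re (D 0 i)).
Proof.
rewrite (@vN_entropy_seq _ _ [seq D 0 i | i : 'I_n]) ?big_image //.
rewrite char_poly_trig ?diag_mx_is_trig //=.
by apply: eq_bigr => i _; rewrite mxE eqxx mulr1n.
Qed.

Lemma vN_entropy_tr n (A : 'M[C]_n) : vN_entropy A^T = vN_entropy A.
Proof.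
apply: vN_entropy_seq; rewrite -spectrumE /char_poly -det_tr; congr (\det _).
by rewrite /char_poly_mx linearB /= tr_scalar_mx map_trmx trmxK.
Qed.
End Entropy.

(** * Positive kernels on finite types *)

Section Kernels.
Variable R : realType.
Local Notation C := R[i].
Local Notation "x %:C" := (real_complex R x).
Implicit Types T U I J A B : finType.

(** Operators are handled below as kernels on finite types: a tensor product is then a product type,
    and a relabelling of the basis is a bijection, with no arithmetic on matrix indices. *)
Definition kmx T U (f : T -> U -> C) : 'M[C]_(#|T|, #|U|) :=
  \matrix_(i, j) f (enum_val i) (enum_val j).

Lemma eq_kmx T U (f g : T -> U -> C) : f =2 g -> kmx f = kmx g.
Proof. by move=> fg; apply/matrixP => i j; rewrite !mxE fg. Qed.

Lemma sum_enum_val (V : nmodType) T (F : T -> V) :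
  \sum_(i < #|T|) F (enum_val i) = \sum_x F x.
Proof. by rewrite [RHS](reindex (@enum_val T T)) //; exact/onW_bij/enum_val_bij. Qed.

Lemma kmxM T U I (f : T -> U -> C) (g : U -> I -> C) :
  kmx f *m kmx g = kmx (fun x z => \sum_y f x y * g y z).
Proof.
apply/matrixP => i j; rewrite !mxE -[RHS]sum_enum_val.
by apply: eq_bigr => k _; rewrite !mxE.
Qed.

Definition ent T (K : T -> T -> C) : R := vN_entropy (kmx K).

Lemma eq_ent T (K L : T -> T -> C) : K =2 L -> ent K = ent L.
Proof. by move=> KL; rewrite /ent (eq_kmx KL). Qed.

Lemma ent_tr T (K : T -> T -> C) : ent (fun x y => K y x) = ent K.
Proof.
rewrite /ent -[RHS]vN_entropy_tr; congr vN_entropy.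
by apply/matrixP => i j; rewrite !mxE.
Qed.

(** Relabelling, diagonalization and purification below are all instances of this swap of two
    rectangular factors. *)
Lemma ent_mulC T U (f : T -> U -> C) (g : U -> T -> C) :
  ent (fun x z => \sum_y f x y * g y z) = ent (fun x z => \sum_y g x y * f y z).
Proof. by rewrite /ent -!kmxM vN_entropy_mulC. Qed.

Lemma sum_deltal T (V : pzSemiRingType) (F : T -> V) a : \sum_x (a == x)%:R * F x = F a.
Proof.
rewrite (bigD1 a) //= eqxx mul1r big1 ?addr0 // => x /negPf xa.
by rewrite eq_sym xa mul0r.
Qed.

Lemma sum_deltar T (V : pzSemiRingType) (F : T -> V) a : \sum_x F x * (x == a)%:R = F a.
Proof.
rewrite (bigD1 a) //= eqxx mulr1 big1 ?addr0 // => x /negPf xa.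
by rewrite xa mulr0.
Qed.

(** The relabelled kernel is [K] conjugated by the permutation matrix [P] of [h]; moving [P] to the
    other side cancels it. *)
Lemma ent_bij T U (h : T -> U) (K : U -> U -> C) :
  bijective h -> ent (fun x y => K (h x) (h y)) = ent K.
Proof.
move=> bh; pose P (t : T) u : C := (h t == u)%:R.
rewrite (@eq_ent _ _ (fun x y => \sum_u P x u * K u (h y))); last first.
  by move=> x y; rewrite sum_deltal.
rewrite (ent_mulC P); apply: eq_ent => u v.
have [g hg gh] := bh; rewrite (reindex g); last by exists h => ? _; rewrite ?hg ?gh.
under eq_bigr => i _ do rewrite /P gh.
by rewrite sum_deltar.
Qed.

(** * Quadratic forms, orthonormal bases and diagonalization *)

Definition ip T (v w : T -> C) : C := \sum_x (v x)^* * w x.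
Definition qf T (K : T -> T -> C) (v : T -> C) : C :=
  \sum_x \sum_y (v x)^* * K x y * v y.
Definition psdk T (K : T -> T -> C) := forall v, 0 <= qf K v.

(** The index type [I] is independent of [T], so completeness is recorded next to orthonormality. *)
Definition onb T I (u : I -> T -> C) :=
  (forall k l, ip (u k) (u l) = (k == l)%:R) /\
  (forall x y, \sum_k u k x * (u k y)^* = (x == y)%:R).

Definition eigensys T I (K : T -> T -> C) (lam : I -> R) (u : I -> T -> C) :=
  [/\ onb u, forall k, 0 <= lam k &
      forall x y, K x y = \sum_k (lam k)%:C * u k x * (u k y)^* ].

Lemma ip_conj T (v w : T -> C) : (ip v w)^* = ip w v.
Proof.
rewrite /ip rmorph_sum; apply: eq_bigr => x _.
by rewrite rmorphM /= conjCK mulrC.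
Qed.

Lemma qf_sum T I (K : T -> T -> C) (d : I -> C) (u : I -> T -> C) v :
  (forall x y, K x y = \sum_k d k * u k x * (u k y)^* ) ->
  qf K v = \sum_k d k * (ip v (u k) * (ip v (u k))^* ).
Proof.
move=> KE; rewrite /qf.
under eq_bigr => x _ do under eq_bigr => y _ do rewrite KE mulr_sumr mulr_suml.
under eq_bigr => x _ do rewrite exchange_big.
rewrite exchange_big; apply: eq_bigr => k _ /=.
rewrite ip_conj /ip mulr_suml mulr_sumr; apply: eq_bigr => x _.
rewrite !mulr_sumr; apply: eq_bigr => y _; ring.
Qed.

(** With [U] the matrix of eigenvectors, [K] is the product of [U Lambda] and the adjoint of [U].
    Swapping the two factors leaves the diagonal matrix [Lambda] by orthonormality. *)
Lemma ent_eigen T I (K : T -> T -> C) (lam : I -> R) (u : I -> T -> C) :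
  eigensys K lam u -> ent K = - \sum_k lam k * ln (lam k).
Proof.
case=> -[ou _] _ KE.
rewrite (@eq_ent _ _ (fun x y => \sum_k ((lam k)%:C * u k x) * (u k y)^* )) //.
rewrite (ent_mulC (fun x k => (lam k)%:C * u k x) (fun k y => (u k y)^* )).
rewrite (@eq_ent _ _ (fun k l : I => (lam k)%:C * (k == l)%:R)); last first.
  move=> k l; have := ou k l; rewrite /ip => E.
  under eq_bigr => x _ do rewrite mulrCA.
  rewrite -mulr_sumr E; case: eqP => [->//|_]; by rewrite !mulr0.
have -> : ent (fun k l : I => (lam k)%:C * (k == l)%:R) =
    vN_entropy (diag_mx (\row_(i < #|I|) (lam (enum_val i))%:C)).
  congr vN_entropy; apply/matrixP => i j; rewrite !mxE (inj_eq enum_val_inj).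
  by rewrite mulr_natr.
rewrite vN_entropy_diag -[in RHS]sum_enum_val; congr (- _).
by apply: eq_bigr => i _; rewrite !mxE.
Qed.

(** Polarization: a nonnegative complex number is real, so the form is real at [e_a + c e_b]. Taking
    [c = 0] shows that diagonal entries are real; [c = 1] and [c = i] give two linear equations that
    determine the conjugate of an off-diagonal entry. *)
Lemma psdk_herm T (K : T -> T -> C) : psdk K -> forall x y, K y x = (K x y)^*.
Proof.
move=> pK.
have Q a b (c : C) : qf K (fun x => (a == x)%:R + c * (b == x)%:R) =
   c * K a b + c^* * K b a + (K a a + c^* * c * K b b).
  rewrite /qf.
  have E x : \sum_y ((a == x)%:R + c * (b == x)%:R)^* * K x y * ((a == y)%:R + c * (b == y)%:R)
     = (a == x)%:R * (K x a + c * K x b) + (b == x)%:R * (c^* * (K x a + c * K x b)).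
    rewrite rmorphD rmorphM !rmorph_nat.
    under eq_bigr => y _.
      rewrite (_ : _ * _ = (a == y)%:R * (((a == x)%:R + c^* * (b == x)%:R) * K x y) +
        (b == y)%:R * (((a == x)%:R + c^* * (b == x)%:R) * (c * K x y))); last by ring.
      over.
    rewrite big_split /= !sum_deltal; ring.
  under eq_bigr => x _ do rewrite E.
  rewrite big_split /= !sum_deltal; ring.
have Kr x : (K x x)^* = K x x.
  have := pK (fun y => (x == y)%:R + 0 * (x == y)%:R).
  by rewrite Q rmorph0 !mul0r !addr0 !add0r => /geC0_conj.
move=> a b.
have Qr (c : C) : c^* * (K a b)^* + c * (K b a)^* = c * K a b + c^* * K b a.
  have := pK (fun x => (a == x)%:R + c * (b == x)%:R).
  rewrite Q => /geC0_conj; rewrite !rmorphD !rmorphM /= conjCK !Kr.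
  by rewrite [c * c^*]mulrC => /addIr.
have := Qr 'i; have := Qr 1; rewrite conjCi rmorph1 !mul1r !mulNr => E1 E2.
have E3 : (K a b)^* - (K b a)^* = - K a b + K b a.
  apply: (@mulfI _ (- 'i)); first by rewrite oppr_eq0 neq0Ci.
  by transitivity (- ('i * (K a b)^* ) + 'i * (K b a)^* ); [ring|rewrite E2; ring].
apply: (@mulfI _ 2); first by rewrite pnatr_eq0.
transitivity ((K a b)^* + (K b a)^* + ((K a b)^* - (K b a)^* )); last by ring.
by rewrite E1 E3; ring.
Qed.

Lemma psdk_eigen T (K : T -> T -> C) : psdk K ->
  exists (lam : T -> R) (u : T -> T -> C), eigensys K lam u.
Proof.
move=> pK; pose A := kmx K.
pose P := spectralmx A; pose D := spectral_diag A.
have nA : A \is normalmx.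
  have AA : (A ^t* )%sesqui = A.
    apply/matrixP => i j; rewrite !mxE; exact/esym/psdk_herm.
  by apply/normalmxP; rewrite AA.
have uP : P \is unitarymx by exact: spectral_unitarymx.
have AE : A = (P ^t* )%sesqui *m diag_mx D *m P.
  by rewrite -invmx_unitary //; exact/orthomx_spectralP.
(* In [A = P^* D P] the eigenvectors are the conjugated rows of [P]. *)
pose u k x : C := (P (enum_rank k) (enum_rank x))^*.
pose d (k : T) : C := D 0 (enum_rank k).
have KE x y : K x y = \sum_k d k * u k x * (u k y)^*.
  have := congr1 (fun M : 'M_(_) => M (enum_rank x) (enum_rank y)) AE.
  rewrite mxE !enum_rankK => ->.
  rewrite mxE -[RHS]sum_enum_val; apply: eq_bigr => k _.
  rewrite mul_mx_diag !mxE /d /u enum_valK conjCK; ring.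
have ou : onb u.
  split=> k l.
    have := congr1 (fun M : 'M_(_) => M (enum_rank k) (enum_rank l)) (unitarymxP uP).
    rewrite [RHS]mxE (inj_eq enum_rank_inj) => <-.
    rewrite mxE -[LHS]sum_enum_val; apply: eq_bigr => x _.
    by rewrite !mxE /u conjCK enum_valK.
  have uP' := mulmx1C (unitarymxP uP).
  have := congr1 (fun M : 'M_(_) => M (enum_rank k) (enum_rank l)) uP'.
  rewrite [RHS]mxE (inj_eq enum_rank_inj) => <-.
  rewrite mxE -[LHS]sum_enum_val; apply: eq_bigr => x _.
  by rewrite !mxE /u conjCK enum_valK.
(* An eigenvalue is the value of the form at its eigenvector, hence real and nonnegative. *)
have dE k : d k = qf K (u k).
  rewrite (qf_sum _ KE); under eq_bigr => l _ do rewrite ou.1 rmorph_nat.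
  rewrite -(sum_deltal d k); apply: eq_bigr => l _.
  by case: (k == l); rewrite ?mulr0 ?mul0r // !mulr1 mul1r.
have dR k : (complex.Re (d k))%:C = d k /\ 0 <= complex.Re (d k).
  have := pK (u k); rewrite -dE; case: (d k) => a b.
  by rewrite lecE /= => /andP[/eqP-> ->].
exists (fun k => complex.Re (d k)), u; split => // [k|x y]; first by case: (dR k).
by rewrite KE; apply: eq_bigr => k _; rewrite (dR k).1.
Qed.

(** * Klein's inequality *)

Definition normsq (z : C) : R := complex.Re z ^+ 2 + complex.Im z ^+ 2.

Lemma normsq_ge0 z : 0 <= normsq z.
Proof. by rewrite addr_ge0 ?sqr_ge0. Qed.

Lemma mul_conj_normsq (z : C) : z * z^* = (normsq z)%:C.
Proof.
by case: z => a b; apply/eqP; rewrite eq_complex /normsq /=; apply/andP;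
  split; apply/eqP; ring.
Qed.

Lemma realC_inj : injective (real_complex R).
Proof. by move=> x y []. Qed.

Lemma parseval T I (w : I -> T -> C) v : onb w ->
  \sum_i ip (w i) v * (ip (w i) v)^* = ip v v.
Proof.
case=> _ cw.
have E i : ip (w i) v * (ip (w i) v)^* =
    \sum_x \sum_y v x * (v y)^* * (w i y * (w i x)^* ).
  rewrite ip_conj /ip mulr_suml; apply: eq_bigr => x _.
  by rewrite mulr_sumr; apply: eq_bigr => y _; ring.
under eq_bigr => i _ do rewrite E.
rewrite exchange_big; apply: eq_bigr => x _ /=.
rewrite exchange_big /=; under eq_bigr => y _ do rewrite -mulr_sumr cw.
by rewrite sum_deltar mulrC.
Qed.

(** This is [ln t <= t - 1] at [t = q / x], multiplied by [x]. *)
Lemma klein_ineq (x q : R) : 0 < x -> 0 < q -> x - q <= x * (ln x - ln q).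
Proof.
move=> x0 q0; have := @le_ln1Dx R (q / x - 1).
rewrite [1 + _]addrC subrK ltrBrDl subrr divr_gt0 // ln_div ?posrE // => /(_ isT).
rewrite -(ler_pM2l x0) !mulrBr mulr1 mulrCA divff ?gt_eqF // mulr1.
lra.
Qed.

(** This is nonnegativity of the relative entropy of [K] with respect to the operator with
    eigenvalues [q] in the basis [w]. The squared overlaps [P i k] have row and column sums 1, so
    summing the scalar inequality with these weights leaves the difference of the traces on one side
    and that of the entropies on the other. *)
Lemma klein T I J K (lam : J -> R) (u : J -> T -> C) (w : I -> T -> C) (D q : I -> R) :
  eigensys K lam u -> onb w -> (forall i, (D i)%:C = qf K (w i)) ->
  (forall i, 0 <= q i) -> \sum_i q i <= \sum_k lam k ->
  (forall i, q i = 0 -> D i = 0) ->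
  ent K <= - \sum_i D i * ln (q i).
Proof.
move=> eK ow DE q0 qs qD; rewrite (ent_eigen eK) lerN2.
have [ou l0 KE] := eK.
pose P i k := normsq (ip (w i) (u k)).
have P0 i k : 0 <= P i k by exact: normsq_ge0.
have DP i : D i = \sum_k lam k * P i k.
  apply: realC_inj; rewrite DE (qf_sum _ KE) rmorph_sum.
  by apply: eq_bigr => k _; rewrite rmorphM /= -mul_conj_normsq.
have P1 k : \sum_i P i k = 1.
  apply: realC_inj; rewrite rmorph1 rmorph_sum /=.
  under eq_bigr => i _ do rewrite -mul_conj_normsq.
  by rewrite (parseval _ ow) ou.1 eqxx.
have P2 i : \sum_k P i k = 1.
  apply: realC_inj; rewrite rmorph1 rmorph_sum /=.
  under eq_bigr => k _ do rewrite -mul_conj_normsq -ip_conj conjCK mulrC.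
  by rewrite (parseval _ ou) ow.1 eqxx.
have H i k : P i k * (lam k - q i) <= P i k * (lam k * (ln (lam k) - ln (q i))).
  (* The scalar inequality needs positive arguments. If [lam k * P i k = 0], the right side vanishes
     and the left is at most 0. Otherwise [D i], a sum of nonnegative terms, is nonzero, and the
     support condition forces [0 < q i]. *)
  have [Z|NZ] := eqVneq (lam k * P i k) 0.
    have -> : P i k * (lam k - q i) = lam k * P i k - P i k * q i by ring.
    by rewrite mulrA [P i k * lam k]mulrC Z mul0r add0r oppr_le0 mulr_ge0.
  have Pk : 0 <= P i k by [].
  rewrite ler_wpM2l //; apply: klein_ineq; rewrite lt_neqAle ?l0 ?q0 andbT eq_sym.
    by apply: contraNneq NZ => ->; rewrite mul0r.
  apply: contraNneq NZ => /qD; rewrite DP => /eqP.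
  by rewrite psumr_eq0 => [/allP/(_ k)|j _]; [apply; rewrite mem_index_enum|rewrite mulr_ge0].
have HS : \sum_i \sum_k P i k * (lam k - q i) <=
    \sum_i \sum_k P i k * (lam k * (ln (lam k) - ln (q i))).
  by apply: ler_sum => i _; apply: ler_sum.
have E1 : \sum_i \sum_k P i k * (lam k - q i) = \sum_k lam k - \sum_i q i.
  have E i : \sum_k P i k * (lam k - q i) = \sum_k P i k * lam k - q i.
    rewrite -[q i in RHS]mul1r -(P2 i) mulr_suml -sumrB.
    by apply: eq_bigr => k _; rewrite mulrBr.
  under eq_bigr => i _ do rewrite E.
  rewrite sumrB; congr (_ - _); rewrite exchange_big; apply: eq_bigr => k _ /=.
  by rewrite -mulr_suml P1 mul1r.
have E2 : \sum_i \sum_k P i k * (lam k * (ln (lam k) - ln (q i))) =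
    \sum_k lam k * ln (lam k) - \sum_i D i * ln (q i).
  have E i : \sum_k P i k * (lam k * (ln (lam k) - ln (q i))) =
     \sum_k P i k * (lam k * ln (lam k)) - D i * ln (q i).
    rewrite DP mulr_suml -sumrB.
    by apply: eq_bigr => k _; ring.
  under eq_bigr => i _ do rewrite E.
  rewrite sumrB; congr (_ - _); rewrite exchange_big; apply: eq_bigr => k _ /=.
  by rewrite -mulr_suml P1 mul1r.
by rewrite E1 E2 in HS; rewrite -subr_ge0 (le_trans _ HS) // subr_ge0.
Qed.

(** * Trace and elementary entropy bounds *)

Definition ktr T (K : T -> T -> C) : C := \sum_x K x x.

Lemma eigen_tr T I (K : T -> T -> C) lam (u : I -> T -> C) :
  eigensys K lam u -> (\sum_k lam k)%:C = ktr K.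
Proof.
case=> [[ou _] _ KE]; rewrite /ktr; under [RHS]eq_bigr => x _ do rewrite KE.
rewrite exchange_big rmorph_sum; apply: eq_bigr => k _ /=.
have E : ip (u k) (u k) = 1 by rewrite ou eqxx.
rewrite -[LHS]mulr1 -E mulr_sumr.
by apply: eq_bigr => x _; ring.
Qed.

Lemma eigen_sum1 T I (K : T -> T -> C) lam (u : I -> T -> C) :
  eigensys K lam u -> ktr K = 1 -> \sum_k lam k = 1.
Proof. by move=> /eigen_tr <- E; apply: realC_inj; rewrite E. Qed.

Lemma onb_delta T : onb (fun k x : T => (k == x)%:R : C).
Proof.
split=> [k l|x y]; rewrite /ip.
  under eq_bigr => x _ do rewrite rmorph_nat.
  by rewrite sum_deltal eq_sym.
under eq_bigr => k _ do rewrite rmorph_nat mulrC [k == y]eq_sym.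
by rewrite sum_deltal eq_sym.
Qed.

Lemma qf_delta T (K : T -> T -> C) k : qf K (fun x => (k == x)%:R) = K k k.
Proof.
rewrite /qf; under eq_bigr => x _ do
  under eq_bigr => y _ do rewrite rmorph_nat [_ * K _ _]mulrC [k == y]eq_sym.
under eq_bigr => x _ do rewrite sum_deltar mulrC.
by rewrite sum_deltal.
Qed.

Lemma psdk_diag_real T (K : T -> T -> C) (I : finType) (w : I -> T -> C) : psdk K ->
  exists2 D : I -> R, (forall i, (D i)%:C = qf K (w i)) & forall i, 0 <= D i.
Proof.
move=> pK; exists (fun i => complex.Re (qf K (w i))) => i;
  have := pK (w i); case: (qf K (w i)) => a b.
all: by rewrite lecE /= => /andP[/eqP E0 H]; rewrite ?E0.
Qed.

Lemma ent_ge0 T (K : T -> T -> C) : psdk K -> ktr K = 1 -> 0 <= ent K.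
Proof.
move=> pK tK; have [lam [u eK]] := psdk_eigen pK.
rewrite (ent_eigen eK) -sumrN; apply: sumr_ge0 => k _.
have [_ l0 _] := eK; rewrite -mulrN mulr_ge0 // oppr_ge0; apply: ln_le0.
rewrite -(eigen_sum1 eK tK) (bigD1 k) //= lerDl; exact: sumr_ge0.
Qed.

(** Klein's inequality against the maximally mixed state, in the standard basis. *)
Lemma ent_le_ln_card T (K : T -> T -> C) : psdk K -> ktr K = 1 -> ent K <= ln #|T|%:R.
Proof.
move=> pK tK; have [lam [u eK]] := psdk_eigen pK.
have [D DE D0] := psdk_diag_real (fun k x : T => (k == x)%:R) pK.
have D1 : \sum_i D i = 1.
  apply: realC_inj; rewrite rmorph1 rmorph_sum -tK; apply: eq_bigr => i _.
  by rewrite /= DE qf_delta.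
have T0 : (0 < #|T|)%N.
  rewrite lt0n; apply: contra_eq_neq D1 => /card0_eq T0.
  by rewrite big_pred0 1?eq_sym ?oner_neq0 // => i; have := T0 i.
have T0' : 0 < #|T|%:R :> R by rewrite ltr0n.
apply: le_trans (klein (q := fun => #|T|%:R^-1) eK (@onb_delta T) DE _ _ _) _.
- by move=> i; rewrite invr_ge0 ler0n.
- by rewrite (eigen_sum1 eK tK) sumr_const -[_ *+ _]mulr_natr mulVf ?gt_eqF.
- by move=> i /eqP; rewrite invr_eq0 gt_eqF.
by rewrite -mulr_suml D1 mul1r lnV ?posrE // opprK.
Qed.

(** * Tensor products, partial traces and subadditivity *)

Lemma sum_pair (V : nmodType) A B (F : A * B -> V) : \sum_p F p = \sum_a \sum_b F (a, b).
Proof. by rewrite pair_bigA; apply: eq_bigr => -[]. Qed.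

Lemma psdk_sum T I (K : T -> T -> C) (d : I -> R) (u : I -> T -> C) :
  (forall k, 0 <= d k) ->
  (forall x y, K x y = \sum_k (d k)%:C * u k x * (u k y)^* ) -> psdk K.
Proof.
move=> d0 KE v; rewrite (qf_sum v KE); apply: sumr_ge0 => k _.
by rewrite mul_conj_normsq -rmorphM /= (lecR 0) mulr_ge0 ?normsq_ge0.
Qed.

(** Each eigenvector of [K], pulled back along [h] at fixed [c], contributes a rank-one term with
    the same weight. As [h] is arbitrary, this covers both partial traces of a product and the
    marginals formed with [glue]. *)
Lemma psdk_trace_out T U J (K : T -> T -> C) (h : U -> J -> T) :
  psdk K -> psdk (fun x y => \sum_c K (h x c) (h y c)).
Proof.
move=> /psdk_eigen[lam [u [_ l0 KE]]].
apply: (@psdk_sum _ (J * T)%type _ (fun p => lam p.2) (fun p x => u p.2 (h x p.1))).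
  by move=> p; exact: l0.
move=> x y; rewrite sum_pair.
by apply: eq_bigr => c _; rewrite KE.
Qed.

Lemma qf_bij T U (h : T -> U) (K : U -> U -> C) v : bijective h ->
  qf (fun x y => K (h x) (h y)) (fun x => v (h x)) = qf K v.
Proof.
move=> bh; rewrite /qf [RHS](reindex h) /=; last exact: onW_bij.
by apply: eq_bigr => x _; rewrite [RHS](reindex h) //; exact: onW_bij.
Qed.

Lemma ktr_bij T U (h : T -> U) (K : U -> U -> C) : bijective h ->
  ktr (fun x y => K (h x) (h y)) = ktr K.
Proof. by move=> bh; rewrite /ktr [RHS](reindex h) //; exact: onW_bij. Qed.

Lemma onb_tensor A B I J (v : I -> A -> C) (w : J -> B -> C) : onb v -> onb w ->
  onb (fun (k : I * J) (x : A * B) => v k.1 x.1 * w k.2 x.2).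
Proof.
move=> [ov cv] [ow cw]; split=> -[k1 k2] [l1 l2]; rewrite /ip /=.
  rewrite sum_pair /=.
  rewrite xpair_eqE -mulnb natrM -ov -ow [RHS]mulr_suml; apply: eq_bigr => a _.
  by rewrite [RHS]mulr_sumr; apply: eq_bigr => b _; rewrite rmorphM /=; ring.
rewrite sum_pair /=.
rewrite xpair_eqE -mulnb natrM -cv -cw [RHS]mulr_suml; apply: eq_bigr => a _.
by rewrite [RHS]mulr_sumr; apply: eq_bigr => b _; rewrite rmorphM /=; ring.
Qed.

(** A partial trace may be taken in any basis: completeness of [w] collapses the sum over [l] to the
    diagonal [b = b']. *)
Lemma sum_qf_tensor A B J (K : A * B -> A * B -> C) (v : A -> C) (w : J -> B -> C) :
  onb w -> \sum_l qf K (fun x => v x.1 * w l x.2) =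
  qf (fun a a' => \sum_b K (a, b) (a', b)) v.
Proof.
move=> [_ cw].
have E l : qf K (fun x => v x.1 * w l x.2) = \sum_a \sum_a' \sum_b \sum_b'
    ((v a)^* * v a' * K (a, b) (a', b')) * (w l b' * (w l b)^* ).
  rewrite /qf sum_pair /=.
  apply: eq_bigr => a _; rewrite exchange_big /=.
  rewrite sum_pair /=.
  apply: eq_bigr => a' _; rewrite exchange_big /=.
  by apply: eq_bigr => b _; apply: eq_bigr => b' _; rewrite rmorphM /=; ring.
under eq_bigr => l _ do rewrite E.
rewrite exchange_big; apply: eq_bigr => a _ /=.
rewrite exchange_big; apply: eq_bigr => a' _ /=.
rewrite exchange_big mulr_sumr mulr_suml; apply: eq_bigr => b _ /=.
rewrite exchange_big /=; under eq_bigr => b' _ do rewrite -mulr_sumr cw.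
by rewrite sum_deltar; ring.
Qed.

Lemma sum_qf_tensorl A B I (K : A * B -> A * B -> C) (v : I -> A -> C) (w : B -> C) :
  onb v -> \sum_k qf K (fun x => v k x.1 * w x.2) =
  qf (fun b b' => \sum_a K (a, b) (a, b')) w.
Proof.
move=> ov; pose sw (p : B * A) := (p.2, p.1).
have bsw : bijective sw by exists (fun p => (p.2, p.1)) => -[].
rewrite -(sum_qf_tensor (fun x y => K (sw x) (sw y)) w ov).
apply: eq_bigr => k _; rewrite -(qf_bij _ _ bsw).
by apply: eq_bigr => x _; apply: eq_bigr => y _; rewrite ![v k _ * _]mulrC.
Qed.

Lemma qf_eigen T I (K : T -> T -> C) lam (u : I -> T -> C) k :
  eigensys K lam u -> qf K (u k) = (lam k)%:C.
Proof.
case=> [[ou _] _ KE]; rewrite (qf_sum _ KE).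
under eq_bigr => l _ do rewrite ou rmorph_nat mulrC -natrM mulnb andbb.
by rewrite sum_deltal.
Qed.

(** The diagonal [D] of [K] in the product eigenbasis is a joint distribution whose marginals are
    the two spectra [al] and [be]. Hence its cross entropy with the product distribution splits into
    the two marginal entropies. *)
Lemma ent_subadditive A B (K : A * B -> A * B -> C) : psdk K -> ktr K = 1 ->
  ent K <= ent (fun a a' => \sum_b K (a, b) (a', b)) +
           ent (fun b b' => \sum_a K (a, b) (a, b')).
Proof.
move=> pK tK.
have [lam [u eK]] := psdk_eigen pK.
have [al [v eA]] := psdk_eigen (psdk_trace_out (fun a b => (a, b)) pK).
have [be [w eB]] := psdk_eigen (psdk_trace_out (fun b a => (a, b)) pK).
have [[ov a0 _] [ow b0 _]] := (eA, eB).
have [D DE D0] := psdk_diag_real (fun (k : A * B) (x : A * B) => v k.1 x.1 * w k.2 x.2) pK.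
have DA k : \sum_l D (k, l) = al k.
  apply: realC_inj; rewrite -(qf_eigen k eA) -(sum_qf_tensor K (v k) ow) rmorph_sum.
  by apply: eq_bigr => l _ /=; rewrite DE.
have DB l : \sum_k D (k, l) = be l.
  apply: realC_inj; rewrite -(qf_eigen l eB) -(sum_qf_tensorl K (w l) ov) rmorph_sum.
  by apply: eq_bigr => k _ /=; rewrite DE.
have al1 : \sum_k al k = 1.
  apply: (eigen_sum1 eA); rewrite -tK /ktr.
  by rewrite -(sum_pair (fun p => K p p)).
have be1 : \sum_l be l = 1.
  apply: (eigen_sum1 eB); rewrite -tK /ktr exchange_big.
  by rewrite -(sum_pair (fun p => K p p)).
have Dal k l : al k = 0 -> D (k, l) = 0.
  rewrite -DA => /eqP; rewrite psumr_eq0 // => /allP/(_ l).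
  by rewrite mem_index_enum => /(_ isT)/eqP.
have Dbe k l : be l = 0 -> D (k, l) = 0.
  rewrite -DB => /eqP; rewrite psumr_eq0 // => /allP/(_ k).
  by rewrite mem_index_enum => /(_ isT)/eqP.
apply: le_trans (klein (q := fun k => al k.1 * be k.2) eK (onb_tensor ov ow) DE _ _ _) _.
- by move=> k; rewrite mulr_ge0.
- rewrite (eigen_sum1 eK tK) sum_pair /=.
  by under eq_bigr => k _ do rewrite -mulr_sumr be1 mulr1; rewrite al1.
- by move=> [k l] /= /eqP; rewrite mulf_eq0 => /orP[]/eqP; [exact: Dal|exact: Dbe].
rewrite (ent_eigen eA) (ent_eigen eB) -opprD.
(* The logarithm of a product splits only for positive factors; if one factor is 0, so is
   [D (k, l)]. *)
have E k l : D (k, l) * ln (al k * be l) = D (k, l) * ln (al k) + D (k, l) * ln (be l).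
  have [/Dal->|ak] := eqVneq (al k) 0; first by rewrite !mul0r addr0.
  have [/Dbe->|bl] := eqVneq (be l) 0; first by rewrite !mul0r addr0.
  by rewrite lnM ?posrE ?lt_neqAle ?a0 ?b0 ?andbT 1?eq_sym // mulrDr.
have -> // : \sum_p D p * ln (al p.1 * be p.2) =
    \sum_k al k * ln (al k) + \sum_l be l * ln (be l).
rewrite sum_pair /=.
under eq_bigr => k _ do under eq_bigr => l _ do rewrite E.
under eq_bigr => k _ do rewrite big_split.
rewrite big_split /=; congr (_ + _).
  by apply: eq_bigr => k _; rewrite -DA mulr_suml.
by rewrite exchange_big; apply: eq_bigr => l _; rewrite -DB mulr_suml.
Qed.

(* Purify [K]; the complement of the first factor is then the second factor
   together with the purifying system, which has the entropy of [K]. *)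
Lemma ent_araki_lieb T A B (K : T -> T -> C) (h : A -> B -> T) :
  bijective (fun p => h p.1 p.2) -> psdk K -> ktr K = 1 ->
  ent (fun a a' => \sum_b K (h a b) (h a' b)) <=
  ent (fun b b' => \sum_a K (h a b) (h a b')) + ent K.
Proof.
move=> bh pK tK.
have [lam [u eK]] := psdk_eigen pK; have [ou l0 KE] := eK.
(* The amplitudes of the purification, with a copy of [T] as the purifying system. *)
pose psi x (g : T) : C := (Num.sqrt (lam g))%:C * u g x.
have KP x y : K x y = \sum_g psi x g * (psi y g)^*.
  rewrite KE; apply: eq_bigr => g _; rewrite /psi rmorphM /=.
  have -> : (lam g)%:C = (Num.sqrt (lam g))%:C * ((Num.sqrt (lam g))%:C)^*.
    rewrite mul_conj_normsq /normsq /= expr0n addr0 sqr_sqrtr //.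
  ring.
(* The transpose of the reduced state of [psi] on [B * T]. In this order, [L] and the marginal on
   [A] are the two products of one matrix and its adjoint. *)
pose L (x y : B * T) : C := \sum_a (psi (h a x.1) x.2)^* * psi (h a y.1) y.2.
have LE : ent (fun a a' => \sum_b K (h a b) (h a' b)) = ent L.
  rewrite (@eq_ent _ _ (fun a a' =>
      \sum_(p : B * T) psi (h a p.1) p.2 * (psi (h a' p.1) p.2)^* )).
    exact: (ent_mulC (fun a (p : B * T) => psi (h a p.1) p.2)
                     (fun (p : B * T) a' => (psi (h a' p.1) p.2)^* )).
  move=> a a'; rewrite sum_pair /=.
  by apply: eq_bigr => b _; rewrite KP.
have pL : psdk L.
  apply: (@psdk_sum _ _ _ (fun => 1) (fun a (x : B * T) => (psi (h a x.1) x.2)^* )) => // x y.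
  by apply: eq_bigr => a _; rewrite rmorph1 mul1r conjCK.
have tL : ktr L = 1.
  rewrite -tK -(ktr_bij K bh) /ktr.
  rewrite sum_pair sum_pair /=.
  rewrite [RHS]exchange_big; apply: eq_bigr => b _ /=.
  rewrite exchange_big; apply: eq_bigr => a _; rewrite KP.
  by apply: eq_bigr => g _; rewrite mulrC.
have LB : ent (fun b b' => \sum_g L (b, g) (b', g)) =
    ent (fun b b' => \sum_a K (h a b) (h a b')).
  rewrite -[RHS]ent_tr; apply: eq_ent => b b'; rewrite exchange_big.
  by apply: eq_bigr => a _ /=; rewrite KP; apply: eq_bigr => g _; rewrite mulrC.
have LG : ent (fun g g' => \sum_b L (b, g) (b, g')) = ent K.
  rewrite [RHS](eq_ent KP) (ent_mulC psi (fun g y => (psi y g)^* )).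
  apply: eq_ent => g g'; rewrite [RHS](reindex (fun p => h p.2 p.1)) /=.
    by rewrite sum_pair.
  apply: onW_bij; pose sw (p : B * A) := (p.2, p.1).
  have bsw : bijective sw by exists (fun p => (p.2, p.1)) => -[].
  exact: (bij_comp bh bsw).
by rewrite LE -LB -LG; exact: ent_subadditive.
Qed.

(** Each eigenvalue of [L] is divided by [#|B|] and repeated [#|B|] times; the eigenvectors are
    tensored with the standard basis of [B]. *)
Lemma ent_tensor_mixed A B (L : A -> A -> C) (K : A * B -> A * B -> C) :
  (0 < #|B|)%N -> psdk L -> ktr L = 1 ->
  (forall a a' b b', K (a, b) (a', b') = L a a' * ((b == b')%:R / #|B|%:R)) ->
  ent K = ent L + ln #|B|%:R.
Proof.
move=> B0 pL tL KL; have [lam [u eL]] := psdk_eigen pL; have [ou l0 LE] := eL.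
have B0' : 0 < #|B|%:R :> R by rewrite ltr0n.
have eK : eigensys K (fun p : A * B => lam p.1 / #|B|%:R)
    (fun (p q : A * B) => u p.1 q.1 * (p.2 == q.2)%:R).
  split; [exact: (onb_tensor ou (onb_delta B))|by move=> p; rewrite divr_ge0|].
  move=> [a b] [a' b'] /=; rewrite KL.
  rewrite sum_pair /=.
  rewrite LE mulr_suml; apply: eq_bigr => k _.
  under eq_bigr => c _.
    rewrite (_ : _ * _ = (b == c)%:R *
      ((lam k / #|B|%:R)%:C * u k a * (u k a')^* * (c == b')%:R)).
      over.
    by rewrite [(_ * (c == b')%:R)^*]rmorphM rmorph_nat [c == b]eq_sym; ring.
  rewrite sum_deltal (_ : (lam k / #|B|%:R)%:C = (lam k)%:C / #|B|%:R); first by ring.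
  by rewrite rmorphM fmorphV rmorph_nat.
rewrite (ent_eigen eK) (ent_eigen eL) sum_pair /=.
have E k : \sum_(b : B) lam k / #|B|%:R * ln (lam k / #|B|%:R) =
    lam k * ln (lam k) - lam k * ln #|B|%:R.
  rewrite sumr_const -[_ *+ _]mulr_natr.
  have [->|lk] := eqVneq (lam k) 0; first by rewrite !mul0r subrr.
  have lk0 : 0 < lam k by rewrite lt_neqAle eq_sym lk l0.
  by rewrite ln_div ?posrE //; field; rewrite gt_eqF.
under eq_bigr => k _ do rewrite E.
by rewrite sumrB -mulr_suml (eigen_sum1 eL tL) mul1r opprB addrC.
Qed.

End Kernels.

(** * Marginals *)

Section Marginals.
Variables (R : realType) (d k : nat) (o : 'I_d).
Local Notation C := R[i].
Implicit Types A B Z P Q E : {set 'I_k}.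

(* [o] is a junk value, taken outside [A]. *)
Definition tot A (x : cfg d A) (i : 'I_k) : 'I_d :=
  if insub i is Some u then x u else o.

Definition restr A (f : 'I_k -> 'I_d) : cfg d A := [ffun i => f (val i)].

Lemma tot_restr A f i : i \in A -> tot (restr A f) i = f i.
Proof. by move=> iA; rewrite /tot insubT ffunE. Qed.

Lemma tot_inj A (x y : cfg d A) : {in A, tot x =1 tot y} -> x = y.
Proof.
by move=> xy; apply/ffunP => -[i iA]; have := xy i iA; rewrite /tot insubT.
Qed.

Lemma tot_glue A B (x : cfg d B) (z : cfg d (A :\: B)) i :
  i \in A -> tot (glue x z) i = if i \in B then tot x i else tot z i.
Proof.
move=> iA; rewrite /tot insubT ffunE /=; case: {-}_ / boolP => iB.
  by rewrite iB insubT.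
rewrite (negPf iB) insubT //=; first by rewrite inE iA iB.
by move=> h; rewrite /Sub /=; congr (z _); apply: val_inj.
Qed.

(** Unlike in [glue], the second domain is a free set [Q], so that equalities between sets need no
    transport between types. *)
Definition join Z P Q (x : cfg d P) (y : cfg d Q) : cfg d Z :=
  restr Z (fun i => if i \in P then tot x i else tot y i).

Lemma join_bij Z P Q : P \subset Z -> Q = Z :\: P ->
  bijective (fun p : cfg d P * cfg d Q => join Z p.1 p.2).
Proof.
move=> /subsetP PZ ->; exists (fun z => (restr P (tot z), restr (Z :\: P) (tot z))).
  move=> [x y]; congr (_, _); apply: tot_inj => i iP /=.
    by rewrite tot_restr // tot_restr ?PZ // iP.
  have [iZ iP'] := setDP iP.
  by rewrite tot_restr // tot_restr // (negPf iP').
move=> z; apply: tot_inj => i iZ; rewrite tot_restr //=.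
by case: ifPn => iP; rewrite tot_restr // inE iZ iP.
Qed.

Lemma glue_join Z P (x : cfg d P) (y : cfg d (Z :\: P)) : glue x y = join Z x y.
Proof. by apply: tot_inj => i iZ; rewrite tot_glue // tot_restr. Qed.

Lemma glue_bij Z P : P \subset Z ->
  bijective (fun p : cfg d P * cfg d (Z :\: P) => glue p.1 p.2).
Proof.
by move=> PZ; apply: (eq_bij (join_bij PZ (erefl _))) => -[x y] /=; rewrite glue_join.
Qed.

Lemma entry_ptr A B (rho : op R d A) x y :
  entry (ptr B rho) x y = \sum_(z : cfg d (A :\: B)) entry rho (glue x z) (glue y z).
Proof. by rewrite {1}/entry mxE !enum_rankK. Qed.

(** A configuration of [Z :\: B] splits uniquely into one of [A :\: B] and one of [Z :\: A], so the
    two successive sums merge into one. *)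
Lemma entry_ptr_ptr Z A B (rho : op R d Z) : B \subset A -> A \subset Z ->
  entry (ptr B (ptr A rho)) =2 entry (ptr B rho).
Proof.
move=> BA AZ x y; have /subsetP BA' := BA; have /subsetP AZ' := AZ.
have sAZ : A :\: B \subset Z :\: B by exact: setSD.
have eQ : Z :\: A = (Z :\: B) :\: (A :\: B).
  apply/setP => i; rewrite !inE.
  by case iA: (i \in A); case iB: (i \in B) => //=; rewrite BA' in iA.
rewrite !entry_ptr; under eq_bigr => z _ do rewrite entry_ptr.
rewrite [RHS](reindex _ (onW_bij _ (join_bij sAZ eQ))) /= sum_pair /=.
have E (u : cfg d B) (z : cfg d (A :\: B)) (w : cfg d (Z :\: A)) :
    glue (glue u z) w = glue u (join (Z :\: B) z w) :> cfg d Z.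
  apply: tot_inj => i iZ; rewrite (tot_glue (glue u z) w) //.
  rewrite (tot_glue u (join (Z :\: B) z w)) //.
  have [iA|iA] := boolP (i \in A).
    rewrite tot_glue //; case: (boolP (i \in B)) => // iB.
    by rewrite /join tot_restr inE ?iB ?iA.
  have iB : i \notin B by apply: contra iA; exact: BA'.
  by rewrite (negPf iB) /join tot_restr inE ?iB // (negPf iA).
by apply: eq_bigr => z _; apply: eq_bigr => w _; rewrite !E.
Qed.

Lemma ent_entry A (rho : op R d A) : ent (entry rho) = vN_entropy rho.
Proof. by congr vN_entropy; apply/matrixP => i j; rewrite mxE /entry !enum_valK. Qed.

Lemma psdk_entry A (rho : op R d A) : psd rho -> psdk (entry rho).
Proof.
move=> pr v; have := pr (\col_i v (enum_val i)); congr (0 <= _).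
rewrite /qf exchange_big mxE -[RHS]sum_enum_val; apply: eq_bigr => j _ /=.
rewrite !mxE mulr_suml -[RHS]sum_enum_val; apply: eq_bigr => i _ /=.
by rewrite !mxE /entry !enum_valK.
Qed.

Lemma ktr_entry A (rho : op R d A) : ktr (entry rho) = \tr rho.
Proof.
by rewrite /ktr -sum_enum_val; apply: eq_bigr => i _; rewrite /entry enum_valK.
Qed.

Variable rho : op R d [set: 'I_k].
Hypothesis rho_density : density rho.

Lemma psdk_marg B : psdk (entry (marg B rho)).
Proof.
move=> v.
rewrite (_ : qf _ v = qf (fun x y => \sum_(z : cfg d (setT :\: B))
   entry rho (glue x z) (glue y z)) v).
  exact: (psdk_trace_out (fun x (z : cfg d (setT :\: B)) => glue x z)
            (psdk_entry rho_density.1)).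
by apply: eq_bigr => x _; apply: eq_bigr => y _; rewrite entry_ptr.
Qed.

Lemma ktr_marg B : ktr (entry (marg B rho)) = 1.
Proof.
rewrite -rho_density.2 -ktr_entry -(ktr_bij _ (glue_bij (subsetT B))) /ktr sum_pair.
by apply: eq_bigr => x _; rewrite entry_ptr.
Qed.

Definition marg_entropy B := vN_entropy (marg B rho).

Lemma marg_entropy_ge0 B : 0 <= marg_entropy B.
Proof.
by rewrite /marg_entropy -ent_entry; apply: ent_ge0; [exact: psdk_marg|exact: ktr_marg].
Qed.

Lemma card_cfg B : #|cfg d B| = (d ^ #|B|)%N.
Proof. by rewrite card_ffun card_ord card_sig. Qed.

Lemma marg_entropy_le B : marg_entropy B <= #|B|%:R * ln d%:R.
Proof.
have d0 : 0 < d%:R :> R by rewrite ltr0n (leq_ltn_trans _ (ltn_ord o)).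
rewrite mulr_natl -lnXn // -natrX -card_cfg /marg_entropy -ent_entry.
by apply: ent_le_ln_card; [exact: psdk_marg|exact: ktr_marg].
Qed.

(** The trace runs over an empty set of factors, which has [d ^ 0 = 1] configuration. *)
Lemma marg_entropy_setT : marg_entropy setT = vN_entropy rho.
Proof.
rewrite /marg_entropy -!ent_entry; apply: eq_ent => x y; rewrite entry_ptr.
have G (u : cfg d [set: 'I_k]) (z : cfg d ([set: 'I_k] :\: setT)) : glue u z = u.
  by apply: tot_inj => i iT; rewrite tot_glue // iT.
under eq_bigr => z _ do rewrite !G.
by rewrite sumr_const card_cfg setDv cards0 expn0.
Qed.

Lemma marg_entropy_mixed A E : A \subset E -> #|E :\: A| = 1%N ->
  (forall x y (u v : cfg d (E :\: A)), entry (marg E rho) (glue x u) (glue y v) =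
    entry (marg A rho) x y * ((u == v)%:R / d%:R)) ->
  marg_entropy E = marg_entropy A + ln d%:R.
Proof.
move=> AE c1 H; have cd : #|cfg d (E :\: A)| = d by rewrite card_cfg c1 expn1.
rewrite /marg_entropy -!ent_entry.
rewrite -(ent_bij (entry (marg E rho)) (glue_bij AE)) -[d in ln d%:R]cd.
apply: ent_tensor_mixed; [|exact: psdk_marg|exact: ktr_marg|].
  by rewrite cd (leq_ltn_trans _ (ltn_ord o)).
by move=> x y u v /=; rewrite H cd.
Qed.

(** [ptr] sums over the second argument of [glue], whereas here the first one is summed. The sets
    [E :\: (E :\: A)] and [A] are equal but not convertible, hence the reindexing through [tot] and
    [restr]. *)
Lemma entry_marg_compl A E b b' : A \subset E ->
  \sum_(a : cfg d A) entry (marg E rho) (glue a b) (glue a b') =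
  entry (marg (E :\: A) rho) b b'.
Proof.
move=> AE; rewrite -(entry_ptr_ptr _ (subsetDl E A) (subsetT E)) entry_ptr.
have EA : E :\: (E :\: A) = A by rewrite setDDr setDv set0U; exact/setIidPr.
have bh : bijective (fun a : cfg d A => restr (E :\: (E :\: A)) (tot a)).
  exists (fun z => restr A (tot z)) => x; apply: tot_inj => i iA.
    by rewrite tot_restr // tot_restr // EA.
  by rewrite tot_restr // tot_restr // -EA.
rewrite [RHS](reindex _ (onW_bij _ bh)) /=; apply: eq_bigr => a _.
have G b0 : glue a b0 = glue b0 (restr (E :\: (E :\: A)) (tot a)) :> cfg d E.
  apply: tot_inj => i iE; rewrite !tot_glue // inE iE andbT.
  by case: (boolP (i \in A)) => iA //=; rewrite tot_restr ?EA.
by rewrite !G.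
Qed.

(** Araki-Lieb with the two parts of [E] in both roles: the first half serves to remove an output
    from the past, the second to isolate a single step. *)
Lemma marg_entropy_triangle A E : A \subset E ->
  marg_entropy A <= marg_entropy (E :\: A) + marg_entropy E /\
  marg_entropy (E :\: A) <= marg_entropy A + marg_entropy E.
Proof.
move=> AE; have [pE tE] := (@psdk_marg E, ktr_marg E).
have SA : marg_entropy A = ent (fun a a' => \sum_(b : cfg d (E :\: A))
    entry (marg E rho) (glue a b) (glue a' b)).
  rewrite /marg_entropy -ent_entry; apply: eq_ent => x y.
  by rewrite -(entry_ptr_ptr _ AE (subsetT E)) entry_ptr.
have SB : marg_entropy (E :\: A) = ent (fun b b' => \sum_(a : cfg d A)
    entry (marg E rho) (glue a b) (glue a b')).
  by rewrite /marg_entropy -ent_entry; apply: eq_ent => x y; rewrite entry_marg_compl.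
have bg := glue_bij AE.
rewrite SA SB /marg_entropy -ent_entry; split; first exact: (ent_araki_lieb bg).
apply: (ent_araki_lieb (K := entry (marg E rho)) (h := fun b a => glue a b) _ pE tE).
pose sw (p : cfg d (E :\: A) * cfg d A) := (p.2, p.1).
have bsw : bijective sw by exists (fun p => (p.2, p.1)) => -[].
exact: (bij_comp bg bsw).
Qed.

End Marginals.

(** * Process tensors *)

Section ProcessTensorEntropy.
Variables (R : realType) (n d : nat) (o : 'I_d) (rho : op R d [set: 'I_(2 * n)]).
Hypothesis pt : process_tensor rho.

Let rho_density : density rho := pt.1.

Lemma first_subset a b : (a <= b)%N -> first n a \subset first n b.
Proof. by move=> ab; apply/subsetP => i; rewrite !inE => /leq_trans; apply. Qed.

Lemma firstSD m : first n m.+1 :\: first n m = [set i | val i == m].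
Proof. by apply/setP => i; rewrite !inE ltnS -leqNgt -eqn_leq eq_sym. Qed.

Lemma card_factor m : (m < 2 * n)%N -> #|[set i : 'I_(2 * n) | val i == m]| = 1%N.
Proof.
move=> mn; rewrite (_ : [set _ | _] = [set Ordinal mn]) ?cards1 //.
by apply/setP => i; rewrite !inE.
Qed.

Lemma marg_entropy_factor_le m : (m < 2 * n)%N ->
  marg_entropy rho [set i | val i == m] <= ln d%:R.
Proof.
move=> mn; have := marg_entropy_le o rho_density [set i | val i == m].
by rewrite card_factor // mul1r.
Qed.

Lemma marg_entropy_first_input j : (j < n)%N ->
  marg_entropy rho (first n (2 * j).+1) = marg_entropy rho (first n (2 * j)) + ln d%:R.
Proof.
move=> jn; apply: (marg_entropy_mixed o rho_density (first_subset (leqnSn _))).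
  by rewrite firstSD card_factor // ltn_pmul2l.
(* Causality speaks of a marginal of a marginal, which is first merged into one marginal of the
   whole state. *)
move=> x y u v; rewrite -(pt.2 j jn) /Ups /marg.
by rewrite (entry_ptr_ptr o) // first_subset // mulnS.
Qed.

(** The input adds exactly [ln d], and the output can take away at most [ln d]. *)
Lemma marg_entropy_first_le j : (j < n)%N ->
  marg_entropy rho (first n (2 * j)) <= marg_entropy rho (first n (2 * j.+1)).
Proof.
move=> jn; have lt : ((2 * j).+1 < 2 * n)%N by lia.
have [] := marg_entropy_triangle o rho_density (first_subset (leqnSn (2 * j).+1)).
rewrite firstSD marg_entropy_first_input // mulnS => + _.
have := marg_entropy_factor_le lt; rewrite /= !add2n; lra.
Qed.

Lemma marg_entropy_first_mono i j : (i <= j <= n)%N ->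
  marg_entropy rho (first n (2 * i)) <= marg_entropy rho (first n (2 * j)).
Proof.
elim: j => [|j IH]; first by rewrite leqn0 => /andP[/eqP->].
rewrite leq_eqVlt => /andP[/orP[/eqP-> //|ij] jn].
apply: le_trans (IH _) (marg_entropy_first_le jn); by rewrite -ltnS ij ltnW.
Qed.

Lemma marg_entropy_first0 : marg_entropy rho (first n 0) = 0.
Proof.
apply/eqP; rewrite eq_le marg_entropy_ge0 // andbT.
have := marg_entropy_le o rho_density (first n 0).
by rewrite (_ : first n 0 = set0) ?cards0 ?mul0r //; apply/setP => i; rewrite !inE.
Qed.

Lemma marg_entropy_first_last : marg_entropy rho (first n (2 * n)) = vN_entropy rho.
Proof.
rewrite -marg_entropy_setT //; congr marg_entropy; apply/setP => i.
by rewrite !inE ltn_ord.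
Qed.

Lemma marg_entropy_step j : (j < n)%N -> marg_entropy rho (inp n j :|: outp n j) <=
  marg_entropy rho (first n (2 * j)) + marg_entropy rho (first n (2 * j.+1)).
Proof.
move=> jn; rewrite (_ : _ :|: _ = first n (2 * j.+1) :\: first n (2 * j)).
  have jS : (2 * j <= 2 * j.+1)%N by rewrite leq_mul2l leqnSn.
  by have [] := marg_entropy_triangle o rho_density (first_subset jS).
apply/setP => i; rewrite !inE /=; lia.
Qed.

Lemma sum_step_entropy_le : (0 < n)%N ->
  \sum_(j < n) marg_entropy rho (inp n j :|: outp n j) <=
  (2 * n)%:R * vN_entropy rho - vN_entropy rho.
Proof.
move=> n0; rewrite -marg_entropy_first_last.
set T := marg_entropy rho (first n (2 * n)).
have T0 : 0 <= T by exact: marg_entropy_ge0.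
(* The past of the first step is empty and has entropy 0, so that step costs [T] instead of [2 * T];
   this accounts for the subtracted entropy in the bound. *)
have B (j : 'I_n) : marg_entropy rho (inp n j :|: outp n j) <=
    (if val j == 0%N then 1 else 2) * T.
  have jn := ltn_ord j; apply: le_trans (marg_entropy_step jn) _.
  have H1 : marg_entropy rho (first n (2 * j.+1)) <= T.
    by apply: marg_entropy_first_mono; rewrite jn leqnn.
  have H0 : marg_entropy rho (first n (2 * j)) <= T.
    by apply: marg_entropy_first_mono; rewrite ltnW ?leqnn.
  case: eqP => [j0|_]; last by lra.
  by rewrite [in X in X + _]j0 muln0 marg_entropy_first0; lra.
apply: le_trans (ler_sum _ (fun j _ => B j)) _.
rewrite -mulr_suml.
case: (n) n0 => // m _; rewrite big_ord_recl /=.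
rewrite sumr_const card_ord -[_ *+ m]mulr_natr natrM -natr1; lra.
Qed.

End ProcessTensorEntropy.

(** * The trade-off between Markovian and non-Markovian correlations *)

Theorem theorem2 (R : realType) (n d : nat) (hn : (2 <= n)%N) (hd : (2 <= d)%N)
  (Ups : op R d [set: 'I_(2 * n)]) :
  process_tensor Ups ->
  markov_corr Ups <=
    (2 * n)%:R * ln (d%:R : R)
    - ((2 ^ n - 1)%:R / (2 ^ n - 2)%:R) * nonmarkov_corr Ups.
Proof.
move=> pt; have o : 'I_d by exists 0%N; exact: leq_trans hd.
have n0 : (0 < n)%N by exact: leq_trans hn.
rewrite /markov_corr /nonmarkov_corr sumrB big_split /=.
set P := \sum_(j < n) Defs.S Ups (_ :|: _); set E := vN_entropy Ups.
have E0 : 0 <= E by rewrite /E -(marg_entropy_setT o Ups); exact: marg_entropy_ge0 pt.1 _.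
have PE : P <= (2 * n)%:R * E - E := sum_step_entropy_le o pt n0.
have I j : (j < n)%N -> Defs.S Ups (inp n j) <= ln d%:R.
  by move=> jn; apply: (marg_entropy_factor_le o pt); rewrite ltn_pmul2l.
have O j : (j < n)%N -> Defs.S Ups (outp n j) <= ln d%:R.
  by move=> jn; apply: (marg_entropy_factor_le o pt); lia.
have SI : \sum_(j < n) Defs.S Ups (inp n j) <= n%:R * ln d%:R.
  by rewrite mulr_natl -[X in _ *+ X]card_ord -sumr_const ler_sum // => j _; exact: I.
have SO : \sum_(j < n) Defs.S Ups (outp n j) <= n%:R * ln d%:R.
  by rewrite mulr_natl -[X in _ *+ X]card_ord -sumr_const ler_sum // => j _; exact: O.
have le2n : (2 * n <= 2 ^ n)%N.
  by case: (n) n0 => // m _; rewrite expnS leq_mul2l ltn_expl.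
(* With [m = 2 ^ n - 2], the coefficient becomes [(m + 1) / m]. *)
have -> : (2 ^ n - 1)%:R = (2 ^ n - 2)%:R + 1 :> R.
  by rewrite natr1; congr _%:R; lia.
have m0 : 0 < (2 ^ n - 2)%:R :> R by rewrite ltr0n; lia.
have PE' : P <= ((2 ^ n - 2)%:R + 1) * E.
  apply: le_trans PE _; rewrite -[X in _ - X]mul1r -mulrBl ler_wpM2r //.
  have : (2 * n)%:R <= (2 ^ n)%:R :> R by rewrite ler_nat.
  by rewrite natrB; [lra|lia].
(* After clearing [m], [(m + 1) * (P - E) <= m * P] is the same as [P <= (m + 1) * E]. The term
   [- P] in the Markovian part then absorbs the multiple of the non-Markovian part. *)
have H : ((2 ^ n - 2)%:R + 1) / (2 ^ n - 2)%:R * (P - E) <= P.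
  by rewrite mulrAC ler_pdivrMr //; lra.
rewrite natrM; lra.
Qed.
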